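(* Consider a two-way instance: at each step $t\in[T]$, independently, at most one two-way surrogate type is realized, type $i\sim\{j,k\}$ with probability $f^t_{i\sim\{j,k\}}$, and the item is allocated to the agent selected by the Two-Way SOCS for Display Ads. Fix an agent $j$ and suppose $\frac12\sum_t\sum_i\sum_{k\ne j}f^t_{i\sim\{j,k\}}\le1$. For $w>0$ let $y_j(w)=\frac12\sum_t\sum_{i:w_{ij}\ge w}\sum_{k\ne j}f^t_{i\sim\{j,k\}}$. Then for every $w>0$, the probability that no item $i$ with $w_{ij}\ge w$ is allocated to $j$ is at most $$g(y_j(w)),\qquad g(y)=\min\Big\{\Big(1+\frac12y\Big)e^{-\frac32y}+\frac{1-y}{15},\ e^{-y}\Big\}.$$
   Context: Agent $j$ has edge weight $w_{ij}\ge0$ for items of type $i$. Two-Way SOCS for Display Ads (stateful): when an item with two-way surrogate type $i\sim\{j,k\}$ arrives: pick $m\in\{j,k\}$ uniformly at random and mark this step with $m$; if this is the second step marked with $m$, select opposite w.r.t. $m$ to the selection at the first step marked with $m$ (select $m$ iff $m$ was not selected there); otherwise select $j$ or $k$ uniformly at random. All random choices are independent. *)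

(* Defs.v *)
From mathcomp Require Import all_boot all_order all_algebra.
From mathcomp Require Import reals sequences exp.

Set Implicit Arguments.
Unset Strict Implicit.
Unset Printing Implicit Defensive.

Import Order.TTheory GRing.Theory Num.Theory.
Local Open Scope ring_scope.

(* [I] is the set of item types and [J] the set of agents.  The two-way
   surrogate type i ~ {j, k} is encoded by i and the two-element set {j, k};
   values of [f] at sets of any other cardinality are never used. *)

(* [None]: nothing is realized.  [Some (i, p, m, s)]: the type i ~ p is
   realized, the step is marked with m, and s is the uniform element of p that
   is used when the selection is not forced. *)
Definition outcome (I J : finType) : Type := option (I * {set J} * J * J).

Definition step_prob (R : realType) (I J : finType) (f : I -> {set J} -> R)
    (o : outcome I J) : R :=
  if o is Some (i, p, m, s) then
    if [&& #|p| == 2, m \in p & s \in p] then f i p * 2^-1 * 2^-1 else 0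
  else 1 - \sum_i \sum_(p : {set J} | #|p| == 2) f i p.

Definition other (J : finType) (p : {set J}) (m : J) : J :=
  odflt m [pick k in p :\ m].

(* A history lists, in chronological order, the item type, the mark and the
   selected agent of each step at which an item arrived. *)
Definition history (I J : finType) : Type := seq (I * J * J).

Definition selections_marked (I J : finType) (h : history I J) (m : J) :
    seq J := [seq x.2 | x <- h & x.1.2 == m].

Definition socs_select (I J : finType) (h : history I J) (p : {set J})
    (m s : J) : J :=
  if selections_marked h m is [:: a] then
    if a == m then other p m else m
  else s.

Definition socs_step (I J : finType) (h : history I J) (o : outcome I J) :
    history I J :=
  if o is Some (i, p, m, s) then rcons h (i, m, socs_select h p m s) else h.

Definition socs_run (I J : finType) (os : seq (outcome I J)) : history I J :=
  foldl (@socs_step I J) [::] os.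

Definition allocated (I J : finType) (h : history I J) (i : I) (j : J) : bool :=
  has (fun x => (x.1.1 == i) && (x.2 == j)) h.

(* Probability, over independent steps, that the final history satisfies E. *)
Definition socs_prob (R : realType) (I J : finType) (T : nat)
    (f : 'I_T -> I -> {set J} -> R) (E : pred (history I J)) : R :=
  \sum_(os : T.-tuple (outcome I J) | E (socs_run os))
    \prod_(t < T) step_prob (f t) (tnth os t).

Definition two_way_instance (R : realType) (I J : finType) (T : nat)
    (f : 'I_T -> I -> {set J} -> R) : Prop :=
  (forall t i (p : {set J}), #|p| = 2 -> 0 <= f t i p) /\
  (forall t, \sum_i \sum_(p : {set J} | #|p| == 2) f t i p <= 1).

Definition y_above (R : realType) (I J : finType) (T : nat)
    (f : 'I_T -> I -> {set J} -> R) (wt : I -> J -> R) (j : J) (w : R) : R :=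
  2^-1 * \sum_(t < T) \sum_(i | w <= wt i j) \sum_(k | k != j)
    f t i [set j; k].

Definition g_bound (R : realType) (y : R) : R :=
  Num.min ((1 + 2^-1 * y) * expR (- (3 / 2 * y)) + (1 - y) / 15) (expR (- y)).

(* Main.v *)
(* Call an item high if its weight for j is at least w. Given the arrivals and
   the marks, each selection is a fair coin, and the only dependence is that the
   first two selections with the same mark are opposite. Hence the selection at
   a first marked step can be left undecided until the next step with that mark,
   unless the step is high and relevant to j, in which case survival (no high
   item is allocated to j) decides it. So every high step halves the survival
   probability, and two high steps that come first and second among those marked
   with j kill it. The state of j is therefore one of three: no mark yet, one
   high mark, or no forced selection left to fear. With y and z half of the
   remaining high and low mass, the three survival probabilities are bounded, by
   backward induction on the steps, by
     (1 + y/2) exp(-3y/2) + z/15,  exp(-3y/2) + z/5  and  exp(-y).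
   The constants come from q^2 - (2 - q) q^3 <= 1/16 and q^2 - q^3 <= 4/27 for
   q = exp(-y/2), and z <= 1 - y at the start. *)

Require Import Defs.
From mathcomp Require Import all_boot all_order all_algebra.
From mathcomp Require Import boolp reals sequences exp.
From mathcomp Require Import ring lra.

Set Implicit Arguments.
Unset Strict Implicit.
Unset Printing Implicit Defensive.

Import Order.TTheory GRing.Theory Num.Theory.
Local Open Scope ring_scope.

(** * One-step inequalities for the two families of bounds *)

Section Values.
Context {R : realType}.
Implicit Types (v : R -> R -> R) (y z a b u : R).

(* [v0 y z], [v1 y z] and [v2 y z] bound the probability that agent j survives
   when high mass y and low mass z remain: [v0] before the first step marked
   with j, [v1] after one high such step, [v2] once a second such step cannot
   kill for sure. A step has high mass a and low mass b. *)
Record survival_bounds v0 v1 v2 : Prop := SurvivalBounds {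
  bounds_start : [/\ 1 <= v0 0 0, 1 <= v1 0 0 & 1 <= v2 0 0];
  bounds_ge0 y z : 0 <= y -> 0 <= z ->
    [/\ 0 <= v0 y z, 0 <= v1 y z & 0 <= v2 y z];
  bounds_v0 y z a b : 0 <= y -> 0 <= z -> 0 <= a -> 0 <= b -> a + b <= 2^-1 ->
    (1 - 3 / 2 * a - b) * v0 y z + a / 2 * v1 y z + b * v2 y z
      <= v0 (y + a) (z + b);
  bounds_v1 y z a b : 0 <= y -> 0 <= z -> 0 <= a -> 0 <= b -> a + b <= 2^-1 ->
    (1 - 3 / 2 * a - b) * v1 y z + b * v2 y z <= v1 (y + a) (z + b);
  bounds_v2 y z a b : 0 <= y -> 0 <= z -> 0 <= a -> 0 <= b -> a + b <= 2^-1 ->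
    (1 - a) * v2 y z <= v2 (y + a) (z + b) }.

Lemma expRN_ge1B u : 1 - u <= expR (- u).
Proof. exact: expR_ge1Dx. Qed.

Lemma mul_expRN_ge1B y u : (1 - u) * expR (- y) <= expR (- (y + u)).
Proof.
by rewrite opprD expRD mulrC ler_wpM2l ?expR_ge0// expRN_ge1B.
Qed.

(** With all three bounds equal to exp(-y), the weights in the [v0] inequality add up to 1 - a, so
    it reduces to 1 - a <= exp(-a); the [v1] inequality is weaker still. *)
Lemma survival_bounds_exp :
  survival_bounds (fun y _ => expR (- y)) (fun y _ => expR (- y))
    (fun y _ => expR (- y)).
Proof.
split => [|y z _ _|y z a b _ _ a0 b0 _|y z a b _ _ a0 b0 _|y z a b _ _ a0 b0 _].
- by rewrite oppr0 expR0.
- by rewrite expR_ge0.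
- by apply: le_trans (mul_expRN_ge1B y a); lra.
- apply: le_trans (mul_expRN_ge1B y a).
  have := mulr_ge0 a0 (expR_ge0 (- y)); lra.
- exact: mul_expRN_ge1B.
Qed.

(* Of the lower bounds [(1 - u / n) ^+ n] of [expR (- u)], those with n = 1 and
   n = 2 are too weak. *)
Lemma affine_expRN_ge u : 0 <= u <= 1 ->
  1 - 2 / 3 * u <= (1 + u / 3) * expR (- u).
Proof.
move=> /andP[u0 u1].
have -> : expR (- u) = expR (- (u / 4)) ^+ 4.
  by rewrite -expRM_natl; congr expR; lra.
have h : (1 - u / 4) ^+ 4 <= expR (- (u / 4)) ^+ 4.
  by rewrite lerXn2r ?nnegrE ?expR_ge0 ?expRN_ge1B//; lra.
have h3 : 0 <= 1 + u / 3 by lra.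
apply: le_trans (ler_wpM2l h3 h).
have -> : (1 + u / 3) * (1 - u / 4) ^+ 4 = 1 - 2 / 3 * u +
    u ^+ 2 * (1 / 24 + u / 16 - u ^+ 2 / 256 * (13 / 3 - u / 3)) by field.
have : u ^+ 2 <= u by rewrite expr2 ler_piMl.
have u2 : 0 <= u ^+ 2 by rewrite sqr_ge0.
rewrite lerDl => h2; apply: mulr_ge0 => //.
have : u ^+ 2 / 256 * (13 / 3 - u / 3) <= u / 256 * (13 / 3).
  by apply: ler_pM; lra.
lra.
Qed.

(** Low mass b moves the state to [v2]; the slopes 1/15 and 1/5 in z pay for the gaps between [v2]
    and the exponential parts of [v0] and [v1]. The second slope is three times the first, so the
    terms in a z of the [v0] inequality cancel. *)
Lemma survival_bounds_socs :
  survival_bounds (fun y z => (1 + 2^-1 * y) * expR (- (3 / 2 * y)) + z / 15)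
    (fun y z => expR (- (3 / 2 * y)) + z / 5) (fun y _ => expR (- y)).
Proof.
split => [|y z y0 z0|y z a b y0 z0 a0 b0 ab|y z a b y0 z0 a0 b0 ab|
          y z a b _ _ a0 b0 _].
- by rewrite !(mulr0, mul0r, addr0, oppr0) expR0 mulr1.
- have e0 := expR_ge0 (- (3 / 2 * y)); have := mulr_ge0 y0 e0.
  by split; rewrite ?expR_ge0//; lra.
- have Hd : expR (- y) - (1 + 2^-1 * y) * expR (- (3 / 2 * y)) <= 15^-1.
    pose q := expR (- (y / 2)).
    have -> : expR (- y) = q ^+ 2 by rewrite -expRM_natl; congr expR; lra.
    have -> : expR (- (3 / 2 * y)) = q ^+ 3.
      by rewrite -expRM_natl; congr expR; lra.
    have q0 : 0 <= q by apply: expR_ge0.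
    have q1 : 1 - q <= y / 2 by have := expRN_ge1B (y / 2); rewrite -/q; lra.
    have : (2 - q) * q ^+ 3 <= (1 + 2^-1 * y) * q ^+ 3.
      by rewrite ler_wpM2r ?exprn_ge0//; lra.
    have q2 : q <= 1 by rewrite /q -[leRHS]expR0 ler_expR; lra.
    (* This square is q^2 - (2 - q) q^3, and q (1 - q) <= 1/4. *)
    have : (q * (1 - q)) ^+ 2 <= (4^-1) ^+ 2.
      rewrite lerXn2r ?nnegrE ?mulr_ge0//; try lra.
      have := sqr_ge0 (q - 2^-1); lra.
    lra.
  have e0 := expR_ge0 (- (3 / 2 * y)).
  (* With u = 3a/2, the left factor is (1 - 2u/3) + (1 - u) y/2; the two summands are bounded
     separately. *)
  have Ha : (1 - 3 / 2 * a) * ((1 + 2^-1 * y) * expR (- (3 / 2 * y)))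
      + a / 2 * expR (- (3 / 2 * y))
      <= (1 + 2^-1 * (y + a)) * expR (- (3 / 2 * (y + a))).
    rewrite [3 / 2 * (y + a)]mulrDr opprD expRD.
    have h1 : 1 - 2 / 3 * (3 / 2 * a)
        <= (1 + 3 / 2 * a / 3) * expR (- (3 / 2 * a)).
      by apply: affine_expRN_ge; lra.
    have h2 := ler_wpM2l (_ : 0 <= y / 2) (expRN_ge1B (3 / 2 * a)).
    have := ler_wpM2l e0 (lerD h1 (h2 ltac:(lra))).
    lra.
  have := ler_wpM2l b0 Hd.
  have := mulr_ge0 b0 z0; lra.
- have Hd : expR (- y) - expR (- (3 / 2 * y)) <= 5^-1.
    pose q := expR (- (y / 2)).
    have -> : expR (- y) = q ^+ 2 by rewrite -expRM_natl; congr expR; lra.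
    have -> : expR (- (3 / 2 * y)) = q ^+ 3.
      by rewrite -expRM_natl; congr expR; lra.
    have q0 : 0 <= q by apply: expR_ge0.
    (* The product expands to q^3 - q^2 + 4/27, with double root at the maximizer 2/3 of q^2 -
       q^3. *)
    have : 0 <= (q - 2 / 3) ^+ 2 * (q + 1 / 3).
      by rewrite mulr_ge0 ?sqr_ge0//; lra.
    lra.
  have Ha := mul_expRN_ge1B (3 / 2 * y) (3 / 2 * a).
  rewrite -mulrDr in Ha.
  have := ler_wpM2l b0 Hd.
  have := mulr_ge0 b0 z0; have := mulr_ge0 a0 z0; lra.
- exact: mul_expRN_ge1B.
Qed.

End Values.

(* What the future depends on, for an agent m: no step marked with m, one such
   step at which m was selected with conditional probability r, or more. *)
Variant mark_status (R : Type) : Type := Fresh | Once of R | Done.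
Arguments Fresh {R}.
Arguments Done {R}.

(** * The survival recursion and deferred selections *)

Section Survival.
Context {R : realType} {I J : finType}.
Variables (high : pred I) (j : J).
Implicit Types (g : I -> {set J} -> R) (u : J -> mark_status R) (p : {set J})
  (i : I) (m a : J).

Definition upd u m (x : mark_status R) : J -> mark_status R :=
  fun k => if k == m then x else u k.

Definition sel_prob u m a : R :=
  if u m is Once r then if a == m then 1 - r else r else 2^-1.

Definition next_status u m a : J -> mark_status R :=
  upd u m (if u m is Fresh then Once (a == m)%:R else Done).

Definition step_mean g (x : R) (X : I -> {set J} -> J -> R) : R :=
  (1 - \sum_i \sum_(p : {set J} | #|p| == 2) g i p) * x +
  \sum_i \sum_(p : {set J} | #|p| == 2) g i p * (2^-1 * \sum_(m in p) X i p m).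

(** It takes arbitrary statuses, including fractional r that no single history produces, so that
    deferred selections can be expressed. *)
Fixpoint survival (T : nat) : ('I_T -> I -> {set J} -> R) ->
    (J -> mark_status R) -> R :=
  if T is T'.+1 then fun f u =>
    let v := survival (fun t => f (lift ord0 t)) in
    step_mean (f ord0) (v u) (fun i p m => \sum_(a in p)
      sel_prob u m a *
        (if high i && (a == j) then 0 else v (next_status u m a)))
  else fun _ _ => 1.

Lemma upd_upd u m x x' : upd (upd u m x) m x' = upd u m x'.
Proof. by apply: funext => k; rewrite /upd; case: eqP. Qed.

Lemma upd_same u m x : upd u m x m = x.
Proof. by rewrite /upd eqxx. Qed.

Lemma upd_other u m x k : k != m -> upd u m x k = u k.
Proof. by rewrite /upd => /negPf->. Qed.

Lemma next_status_upd_other u m x k a : k != m ->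
  next_status (upd u m x) k a = upd (next_status u k a) m x.
Proof.
move=> km; apply: funext => l; rewrite /next_status (upd_other u x km) /upd.
by case: (eqVneq l k) => [->|_]; rewrite ?(negPf km).
Qed.

Lemma eq_step_mean g x y X Y : x = y -> 
  (forall i p m, #|p| == 2 -> m \in p -> X i p m = Y i p m) ->
  step_mean g x X = step_mean g y Y.
Proof.
move=> -> XY; congr (_ + _); apply: eq_bigr => i _; apply: eq_bigr => p p2.
by congr (_ * (_ * _)); apply: eq_bigr => m mp; exact: XY.
Qed.

Lemma step_meanD g x y X Y :
  step_mean g (x + y) (fun i p m => X i p m + Y i p m)
  = step_mean g x X + step_mean g y Y.
Proof.
rewrite /step_mean mulrDr -!addrA; congr (_ + _); rewrite addrCA; congr (_ + _).
rewrite -big_split; apply: eq_bigr => i _; rewrite -big_split.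
by apply: eq_bigr => p _ /=; rewrite big_split/= !mulrDr.
Qed.

Lemma step_meanZ g c x X :
  step_mean g (c * x) (fun i p m => c * X i p m) = c * step_mean g x X.
Proof.
rewrite /step_mean mulrDr mulrCA; congr (_ + _); rewrite mulr_sumr.
apply: eq_bigr => i _; rewrite mulr_sumr; apply: eq_bigr => p _.
by rewrite -mulr_sumr; ring.
Qed.

(* Deferred decision: a selection that did not affect the survival of j may be
   resolved at the next step with the same mark. *)
Lemma survival_once T (f : 'I_T -> I -> {set J} -> R) u m r :
  survival f (upd u m (Once r)) =
  r * survival f (upd u m (Once 1)) + (1 - r) * survival f (upd u m (Once 0)).
Proof.
elim: T f u => [|T IH] f u /=; first by ring.
rewrite -!step_meanZ -step_meanD; apply: eq_step_mean => [|i p k _ _].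
  exact: IH.
rewrite !mulr_sumr -big_split; apply: eq_bigr => a _ /=.
case: ifP => _; first by rewrite !mulr0 addr0.
rewrite /sel_prob; have [->|km] := eqVneq k m.
  rewrite /next_status !upd_same !upd_upd.
  by case: ifP => _; ring.
rewrite !upd_other// !next_status_upd_other// IH.
by ring.
Qed.

Lemma sum_set2 (F : J -> R) a b : a != b ->
  \sum_(m in [set a; b]) F m = F a + F b.
Proof. by move=> ab; rewrite big_setU1 ?inE//= big_set1. Qed.

Lemma other_set2 m k : k != m -> other [set m; k] m = k.
Proof.
move=> km; rewrite /other; case: pickP => [l|/(_ k)].
  by rewrite !inE => /andP[/negPf-> /= /eqP->].
by rewrite !inE km eqxx orbT.
Qed.

Lemma sum_pairs_mem (F : {set J} -> R) :
  \sum_(p : {set J} | (#|p| == 2) && (j \in p)) F p =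
  \sum_(k | k != j) F [set j; k].
Proof.
rewrite (reindex_onto (fun k => [set j; k]) (fun p => other p j)) /=.
  apply: eq_bigl => k; rewrite !inE eqxx andbT cards2 eq_sym.
  by have [//|kj] := eqVneq k j; rewrite other_set2// eqxx.
move=> p /andP[/cards2P[a [b [ab ->]]]]; rewrite !inE => /orP[]/eqP->.
  by rewrite other_set2// eq_sym.
by rewrite [[set a; b]]setUC other_set2.
Qed.

Definition mass (Q : pred I) g : R :=
  \sum_(i | Q i) \sum_(k | k != j) g i [set j; k].

(** At r = 0 the next step marked with j surely selects j. At r = 1/2 it is a fair coin, as in
    [Done]. *)
Definition status_bound (v0 v1 v2 : R) (x : mark_status R) : R :=
  match x with
  | Fresh => v0
  | Once r => if r == 0 then v1 else v2
  | Done => v2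
  end.

(* Invariant of surviving runs with deferred decisions: r = 1/2 comes from a
   first marked step that was not high, while surviving a first marked high
   step forces r = 1 for the other agent and r = 0 for j. *)
Definition good_status u : Prop :=
  (forall k r, k != j -> u k = Once r -> 2^-1 <= r <= 1) /\
  (forall r, u j = Once r -> r = 0 \/ r = 2^-1).

Lemma good_upd_other u k x : good_status u -> k != j ->
  (forall r, x = Once r -> 2^-1 <= r <= 1) -> good_status (upd u k x).
Proof.
move=> [g1 g2] kj hx; split=> [l r lj|r]; last first.
  by rewrite upd_other 1?eq_sym//; exact: g2.
rewrite /upd; case: ifP => [_|_]; [exact: hx|exact: g1].
Qed.

Lemma good_upd_self u x : good_status u ->
  (forall r, x = Once r -> r = 0 \/ r = 2^-1) -> good_status (upd u j x).
Proof.
move=> [g1 g2] hx; split=> [l r lj|r].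
  by rewrite upd_other//; exact: g1.
by rewrite upd_same; exact: hx.
Qed.

(** * Survival through one step with a given mark *)

Section Marked.
Variables (v : (J -> mark_status R) -> R) (v0 v1 v2 : R).
Hypothesis v_once : forall u m r, v (upd u m (Once r)) =
  r * v (upd u m (Once 1)) + (1 - r) * v (upd u m (Once 0)).
Hypothesis v_le : forall u, good_status u -> v u <= status_bound v0 v1 v2 (u j).
Hypothesis v_ge0 : [/\ 0 <= v0, 0 <= v1 & 0 <= v2].

Lemma status_bound_ge0 x : 0 <= status_bound v0 v1 v2 x.
Proof. by case: v_ge0; case: x => //= r; case: ifP. Qed.

(** From [Fresh], the fair average of [Once 1] and [Once 0] is [Once 2^-1] by [v_once]. Otherwise
    the next status is [Done] for either selection, and the two probabilities add up to 1. *)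
Lemma marked_irrelevant u m k : m != k ->
  sel_prob u m m * v (next_status u m m) +
    sel_prob u m k * v (next_status u m k)
  = v (upd u m (if u m is Fresh then Once 2^-1 else Done)).
Proof.
move=> mk; rewrite /sel_prob /next_status eqxx eq_sym (negPf mk).
case: (u m) => [|r|]; [rewrite (v_once _ _ 2^-1)| |]; lra.
Qed.

Lemma marked_other_low u m k : m != j -> m != k -> good_status u ->
  sel_prob u m m * v (next_status u m m) +
    sel_prob u m k * v (next_status u m k)
  <= status_bound v0 v1 v2 (u j).
Proof.
move=> mj mk gu; rewrite marked_irrelevant//.
set x := (X in upd _ _ X); rewrite -(@upd_other u m x j) 1?eq_sym//.
apply/v_le/good_upd_other => // r; rewrite /x.
by case: (u m) => //= -[<-]; lra.
Qed.

Lemma marked_self_low u k : k != j -> good_status u ->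
  sel_prob u j j * v (next_status u j j) +
    sel_prob u j k * v (next_status u j k)
  <= v2.
Proof.
move=> kj gu; rewrite marked_irrelevant 1?eq_sym//.
set x := (X in upd _ _ X).
have gx : good_status (upd u j x).
  by apply: good_upd_self => // r; rewrite /x; case: (u j) => //= -[<-]; right.
apply: le_trans (v_le gx) _; rewrite upd_same /x.
by case: (u j) => //=; rewrite invr_eq0 pnatr_eq0.
Qed.

(** Survival requires selecting k, which has probability 1/2, or 1 - r <= 1/2 by the invariant r >=
    1/2. *)
Lemma marked_other_high u k : k != j -> good_status u ->
  sel_prob u k k * v (next_status u k k) <= 2^-1 * status_bound v0 v1 v2 (u j).
Proof.
move=> kj gu; have := gu => -[g1 _].
have b0 := status_bound_ge0 (u j).
have gk : v (next_status u k k) <= status_bound v0 v1 v2 (u j).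
  rewrite /next_status; set x := (X in upd _ _ X).
  rewrite -(@upd_other u k x j) 1?eq_sym//.
  apply/v_le/good_upd_other => // r; rewrite /x eqxx.
  by case: (u k) => //= -[<-]; lra.
have [s0 s1] : 0 <= sel_prob u k k /\ sel_prob u k k <= 2^-1.
  rewrite /sel_prob eqxx; case E : (u k) => [|r|]; [lra| |lra].
  by have := g1 _ _ kj E; lra.
exact: le_trans (ler_wpM2l s0 gk) (ler_wpM2r b0 s1).
Qed.

(** The arguments [v1 0 v2] describe the state after the step: [Fresh] becomes [Once 0], [Once 0]
    forces j and kills, and all else becomes [Done]. *)
Lemma marked_self_high u k : k != j -> good_status u ->
  sel_prob u j k * v (next_status u j k) <=
  2^-1 * status_bound v1 0 v2 (u j).
Proof.
move=> kj gu; have := gu => -[_ g2].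
rewrite /sel_prob /next_status (negPf kj).
set x := (X in upd _ _ X).
have gx : good_status (upd u j x).
  by apply: good_upd_self => // r; rewrite /x; case: (u j) => //= -[<-]; left.
have := v_le gx; rewrite upd_same /x.
case E : (u j) => [|r|] //= H.
- by rewrite eqxx in H; rewrite ler_wpM2l//; lra.
- case: (g2 _ E) => ->; first by rewrite eqxx; lra.
  by rewrite invr_eq0 pnatr_eq0/= ler_wpM2l//; lra.
- by rewrite ler_wpM2l//; lra.
Qed.

Definition step_surv u i p m : R :=
  \sum_(a in p) sel_prob u m a *
    (if high i && (a == j) then 0 else v (next_status u m a)).

Lemma step_surv_irrelevant u i p : good_status u -> #|p| == 2 -> j \notin p ->
  2^-1 * \sum_(m in p) step_surv u i p m <= status_bound v0 v1 v2 (u j).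
Proof.
move=> gu /cards2P[a [b [ab ->]]]; rewrite !inE negb_or => /andP[].
rewrite ![j == _]eq_sym => aj bj.
have := marked_other_low aj ab gu.
rewrite eq_sym in ab; have := marked_other_low bj ab gu.
rewrite eq_sym in ab.
rewrite sum_set2// /step_surv !sum_set2// (negPf aj) (negPf bj) andbF; lra.
Qed.

Lemma step_surv_relevant u i k : good_status u -> k != j ->
  2^-1 * \sum_(m in [set j; k]) step_surv u i [set j; k] m <=
  if high i then
    4^-1 * (status_bound v0 v1 v2 (u j) + status_bound v1 0 v2 (u j))
  else 2^-1 * (status_bound v0 v1 v2 (u j) + v2).
Proof.
move=> gu kj; have jk : j != k by rewrite eq_sym.
rewrite sum_set2// /step_surv !sum_set2// eqxx (negPf kj) andbT andbF.
case: ifP => hi.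
  have := marked_self_high kj gu; have := marked_other_high kj gu; lra.
have := marked_self_low kj gu; have := marked_other_low kj kj gu; lra.
Qed.

End Marked.

End Survival.

(** * Backward induction on the steps *)

Section SurvivalProbability.
Context {R : realType} {I J : finType}.
Variables (high : pred I) (j : J).
Implicit Types (g : I -> {set J} -> R) (u : J -> mark_status R) (p : {set J})
  (i : I) (m a : J) (h : history I J).

Lemma sum_pairs g i :
  \sum_(p : {set J} | #|p| == 2) g i p =
  \sum_(k | k != j) g i [set j; k] +
  \sum_(p : {set J} | (#|p| == 2) && (j \notin p)) g i p.
Proof. by rewrite (bigID (fun p => j \in p))/= sum_pairs_mem. Qed.

Lemma mass_ge0 Q g : (forall i p, #|p| = 2 -> 0 <= g i p) -> 0 <= mass j Q g.
Proof.
move=> g0; apply: sumr_ge0 => i _; apply: sumr_ge0 => k kj.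
by apply: g0; rewrite cards2 eq_sym kj.
Qed.

Lemma mass_le1 g : (forall i p, #|p| = 2 -> 0 <= g i p) ->
  \sum_i \sum_(p : {set J} | #|p| == 2) g i p <= 1 ->
  mass j high g + mass j (predC high) g <= 1.
Proof.
move=> g0; apply: le_trans; rewrite (bigID high)/= lerD// ler_sum// => i _.
  rewrite sum_pairs lerDl sumr_ge0// => p /andP[/eqP p2 _]; exact: g0.
rewrite sum_pairs lerDl sumr_ge0// => p /andP[/eqP p2 _]; exact: g0.
Qed.

Lemma step_mean_le g x X V H L : (forall i p, #|p| = 2 -> 0 <= g i p) ->
  \sum_i \sum_(p : {set J} | #|p| == 2) g i p <= 1 -> x <= V ->
  (forall i p, #|p| == 2 -> j \notin p -> 2^-1 * \sum_(m in p) X i p m <= V) ->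
  (forall i k, k != j -> 2^-1 * \sum_(m in [set j; k]) X i [set j; k] m <=
    if high i then H else L) ->
  step_mean g x X <= (1 - mass j high g - mass j (predC high) g) * V
    + mass j high g * H + mass j (predC high) g * L.
Proof.
move=> g0 g1 xV XV XHL.
set S := \sum_i \sum_(p : {set J} | #|p| == 2) g i p in g1 *.
have h1 : (1 - S) * x <= (1 - S) * V by rewrite ler_wpM2l// subr_ge0.
(* Measured against V, only the pairs containing j need a correction. *)
suff h2 : \sum_i \sum_(p : {set J} | #|p| == 2)
      g i p * (2^-1 * \sum_(m in p) X i p m) <=
    S * V + mass j high g * (H - V) + mass j (predC high) g * (L - V).
  by rewrite /step_mean -/S; lra.
have -> : S * V + mass j high g * (H - V) + mass j (predC high) g * (L - V) =
    \sum_i (\sum_(k | k != j) g i [set j; k] * (if high i then H else L) +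
      \sum_(p : {set J} | (#|p| == 2) && (j \notin p)) g i p * V).
  pose A i := \sum_(k | k != j) g i [set j; k].
  pose C i := \sum_(p : {set J} | (#|p| == 2) && (j \notin p)) g i p.
  have massE Q : mass j Q g = \sum_i (if Q i then A i else 0).
    by rewrite -big_mkcond.
  have -> : S = \sum_i (A i + C i) by apply: eq_bigr => i _; exact: sum_pairs.
  rewrite !massE !mulr_suml -!big_split/=.
  apply: eq_bigr => i _; rewrite -!mulr_suml -/(A i) -/(C i).
  by case: (high i) => /=; ring.
apply: ler_sum => i _.
rewrite (sum_pairs (fun i p => g i p * (2^-1 * \sum_(m in p) X i p m))).
apply: lerD; apply: ler_sum; last move=> p /andP[p2 jp].
  by move=> k kj; rewrite ler_wpM2l ?XHL// g0// cards2 eq_sym kj.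
by rewrite ler_wpM2l ?XV// g0//; apply/eqP.
Qed.

Lemma survival_le T (f : 'I_T -> I -> {set J} -> R) v0 v1 v2 u :
  survival_bounds v0 v1 v2 -> two_way_instance f -> good_status j u ->
  let y := 2^-1 * \sum_t mass j high (f t) in
  let z := 2^-1 * \sum_t mass j (predC high) (f t) in
  survival high j f u <= status_bound (v0 y z) (v1 y z) (v2 y z) (u j).
Proof.
move=> B; elim: T f u => [|T IH] f u [f0 f1] gu /=.
  rewrite !big_ord0 mulr0; case: B => -[h0 h1 h2] _ _ _ _.
  by case: (u j) => //= r; case: ifP.
rewrite !big_ord_recl !mulrDr.
set f' := fun t => f (lift ord0 t).
have hf' : two_way_instance f' by split=> [t|t]; [exact: f0|exact: f1].
set y := 2^-1 * \sum_(t < T) mass j high (f' t).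
set z := 2^-1 * \sum_(t < T) mass j (predC high) (f' t).
have y0 : 0 <= y.
  by rewrite mulr_ge0 ?invr_ge0// sumr_ge0// => t _; apply/mass_ge0/hf'.1.
have z0 : 0 <= z.
  by rewrite mulr_ge0 ?invr_ge0// sumr_ge0// => t _; apply/mass_ge0/hf'.1.
have a0 := mass_ge0 high (f0 ord0); have b0 := mass_ge0 (predC high) (f0 ord0).
have ab := mass_le1 (f0 ord0) (f1 ord0).
have vle u' : good_status j u' -> survival high j f' u' <=
    status_bound (v0 y z) (v1 y z) (v2 y z) (u' j) by exact: IH.
have vge := bounds_ge0 B y0 z0.
have := step_mean_le (f0 ord0) (f1 ord0) (vle _ gu)
  (fun i p => step_surv_irrelevant high (survival_once high j f') vle i gu)
  (fun i k => step_surv_relevant high (survival_once high j f') vle vge i gu).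
move=> /le_trans; apply.
set a := mass j high _ in a0 ab *; set b := mass j _ _ in b0 ab *.
rewrite ![_ + y]addrC ![_ + z]addrC.
(* The half masses play the roles of a and b in [survival_bounds]. The state of j keeps weight 1 - a
   - b + a/4 + b/2, which is 1 - 3/2 (a/2) - b/2. *)
have a0' : 0 <= 2^-1 * a by lra.
have b0' : 0 <= 2^-1 * b by lra.
have ab' : 2^-1 * a + 2^-1 * b <= 2^-1 by lra.
have := bounds_v0 B y0 z0 a0' b0' ab'.
have := bounds_v1 B y0 z0 a0' b0' ab'.
have := bounds_v2 B y0 z0 a0' b0' ab'.
by case: (u j) => [|r|] /=; [|case: ifP => _|]; lra.
Qed.

(** * From runs of the algorithm to the survival recursion *)

Definition alive h : bool := ~~ has (fun x => high x.1.1 && (x.2 == j)) h.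

Lemma alive_rcons h i m a :
  alive (rcons h (i, m, a)) = ~~ (high i && (a == j)) && alive h.
Proof. by rewrite /alive has_rcons negb_or. Qed.

Definition survival_prob T (f : 'I_T -> I -> {set J} -> R) h : R :=
  \sum_(os : T.-tuple (outcome I J) | alive (foldl (@socs_step I J) h os))
    \prod_(t < T) step_prob (f t) (tnth os t).

Lemma survival_prob_dead T (f : 'I_T -> I -> {set J} -> R) h :
  ~~ alive h -> survival_prob f h = 0.
Proof.
move=> dead; rewrite /survival_prob big_pred0// => -[os _] /=; apply/negbTE.
elim: os h dead => //= o os IH h dead; apply: IH.
by case: o => [[[[i p] m] s]|]//=; rewrite alive_rcons negb_and dead orbT.
Qed.

Lemma sum_tuple_cons (A : finType) T (F : T.+1.-tuple A -> R) :
  \sum_(os : T.+1.-tuple A) F os =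
  \sum_(o : A) \sum_(os : T.-tuple A) F [tuple of o :: os].
Proof.
rewrite pair_big (reindex (fun x : A * T.-tuple A => [tuple of x.1 :: x.2]))//.
exists (fun os => (thead os, [tuple of behead os])) => [[o os] _|os _] /=.
  by rewrite theadE; congr (_, _); exact: val_inj.
by rewrite [RHS]tuple_eta.
Qed.

Lemma survival_probS T (f : 'I_T.+1 -> I -> {set J} -> R) h :
  survival_prob f h = \sum_(o : outcome I J) step_prob (f ord0) o *
    survival_prob (fun t => f (lift ord0 t)) (socs_step h o).
Proof.
rewrite /survival_prob big_mkcond sum_tuple_cons; apply: eq_bigr => o _.
rewrite mulr_sumr [RHS]big_mkcond; apply: eq_bigr => os _ /=.
case: ifP => // _; rewrite big_ord_recl tnth0; congr (_ * _).
by apply: eq_bigr => t _; rewrite tnthS.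
Qed.

Lemma sum_step_prob g (X : outcome I J -> R) :
  \sum_o step_prob g o * X o =
  step_mean g (X None)
    (fun i p m => 2^-1 * \sum_(s in p) X (Some (i, p, m, s))).
Proof.
rewrite /step_mean (bigD1 None)//=; congr (_ + _).
rewrite (reindex_omap Some id) => [|[]]//=.
transitivity (\sum_i \sum_p \sum_m \sum_s step_prob g (Some (i, p, m, s)) *
    X (Some (i, p, m, s))).
  rewrite !pair_bigA/=; apply: eq_big => [x|[[[i p] m] s] _]//.
  by rewrite eqxx.
apply: eq_bigr => i _; rewrite [RHS]big_mkcond/=; apply: eq_bigr => p _.
case: ifP => p2; last first.
  by rewrite big1// => m _; rewrite big1// => s _; rewrite /= mul0r.
rewrite !mulr_sumr [RHS]big_mkcond/=; apply: eq_bigr => m _.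
case: ifP => mp; last by rewrite big1// => s _; rewrite mul0r.
rewrite !mulr_sumr [RHS]big_mkcond/=; apply: eq_bigr => s _.
by case: ifP => _; rewrite ?mul0r// !mulrA.
Qed.

Definition status_of h m : mark_status R :=
  match selections_marked h m with
  | [::] => Fresh
  | [:: a] => Once (a == m)%:R
  | _ => Done
  end.

Lemma status_of_rcons h i m a :
  status_of (rcons h (i, m, a)) = next_status (status_of h) m a.
Proof.
apply: funext => k; rewrite /next_status /upd /status_of /selections_marked.
rewrite filter_rcons/=; case: (eqVneq k m) => [->|km].
  by rewrite map_rcons; case: [seq x.2 | x <- _ & _] => [|? []].
by [].
Qed.

Lemma survival_probE T (f : 'I_T -> I -> {set J} -> R) h :
  alive h -> survival_prob f h = survival high j f (status_of h).
Proof.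
elim: T f h => [|T IH] f h al.
  rewrite /survival_prob (big_pred1 [tuple]) ?big_ord0// => os.
  by rewrite tuple0/= al eqxx.
rewrite survival_probS sum_step_prob/=; apply: eq_step_mean => [|i p m p2 mp].
  exact: IH.
set Y := fun a => if high i && (a == j) then 0 else
  survival high j (fun t => f (lift ord0 t)) (next_status (status_of h) m a).
have YE a : survival_prob (fun t => f (lift ord0 t)) (rcons h (i, m, a)) = Y a.
  rewrite /Y; case: ifP => ha.
    by rewrite survival_prob_dead// alive_rcons ha.
  by rewrite IH ?alive_rcons ?ha// status_of_rcons.
transitivity (\sum_(a in p) sel_prob (status_of h) m a * Y a); last by [].
under eq_bigr do rewrite YE.
clearbody Y; rewrite /socs_select /sel_prob /status_of.
have [k km pE] : exists2 k, k != m & p = [set m; k].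
  move/cards2P: p2 mp => [a [b [ab ->]]]; rewrite !inE => /orP[]/eqP->.
    by exists b; rewrite // eq_sym.
  by exists a; rewrite // setUC.
have mk : m != k by rewrite eq_sym.
case: (selections_marked h m) => [|a [|? ?]]; rewrite ?mulr_sumr// pE.
(* Only the case of exactly one earlier selection with mark m is left: s is ignored, and [sel_prob]
   puts all its weight on the forced agent. *)
rewrite !sum_set2// eqxx (negPf km) other_set2//.
by case: (a == m); rewrite /= ?mulr1n ?mulr0n; lra.
Qed.

Lemma survival_prob_le T (f : 'I_T -> I -> {set J} -> R) v0 v1 v2 :
  survival_bounds v0 v1 v2 -> two_way_instance f ->
  survival_prob f [::] <= v0 (2^-1 * \sum_t mass j high (f t))
                             (2^-1 * \sum_t mass j (predC high) (f t)).
Proof.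
move=> B hf; rewrite survival_probE//.
by apply: (survival_le (u := status_of [::]) B hf); split.
Qed.

End SurvivalProbability.

Theorem theorem6p1 (R : realType) (I J : finType) (T : nat)
    (wt : I -> J -> R) (hwt : forall i j, 0 <= wt i j)
    (f : 'I_T -> I -> {set J} -> R) (hf : two_way_instance f)
    (j : J)
    (hj : 2^-1 * \sum_(t < T) \sum_i \sum_(k | k != j) f t i [set j; k] <= 1)
    (w : R) (hw : 0 < w) :
  socs_prob f (fun h => [forall (i | w <= wt i j), ~~ allocated h i j])
    <= g_bound (y_above f wt j w).
Proof.
pose high i := w <= wt i j.
have -> : socs_prob f (fun h => [forall (i | high i), ~~ allocated h i j]) =
    survival_prob high j f [::].
  apply: eq_bigl => os; rewrite -/(socs_run os) /alive.
  apply/forall_inP/hasPn => [na [[i m] a] xh|na i hi].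
    apply/negP => /andP[/= hi aj]; move/negP: (na _ hi); apply.
    by apply/hasP; exists (i, m, a); rewrite //= eqxx.
  apply/negP => /hasP[[[i' m] a] /na/= /negP nx /andP[/eqP iE aj]].
  by apply: nx; rewrite iE hi.
rewrite /g_bound le_min; apply/andP; split; last first.
  exact: survival_prob_le survival_bounds_exp hf.
apply: le_trans (survival_prob_le _ _ survival_bounds_socs hf) _.
(* What remains is y + z <= 1, which is [hj] split into high and low types. *)
rewrite lerD2l ler_wpM2r ?invr_ge0// lerBrDl; apply: le_trans hj.
rewrite -mulrDr ler_wpM2l ?invr_ge0// -big_split/= ler_sum// => t _.
by rewrite [leRHS](bigID high).
Qed.
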